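(* Let $k \geq 1$, let $D_1,\ldots,D_k$ be division rings, let $R := D_1 \times \ldots \times D_k$ (with pointwise ring operations), and let $A \subset R$ be a non-empty finite set such that $|A+A| \leq K|A|$ and $|A \cdot A| \leq K|A|$ for some $K \geq 1$. Then one of the following holds: (i) There exists $1 \leq j \leq k$ such that $|\pi_j(A)| \ll k K^{O(1)}$, where $\pi_j: R \to D_j$ is the projection homomorphism. (ii) There exist a finite subring $S$ of $R$ of cardinality $|S| \ll K^{O(1)} |A|$ and an invertible element $a \in A$ such that $a \cdot S = S \cdot a$ and $A \subset a \cdot S + \mathbf{O}( K^{O(1)} )$.
   Context: A subring is an additive subgroup closed under multiplication (it is not required to contain the identity). For subsets $A,B$ of a ring: $A+B := \{a+b : a\in A, b\in B\}$, $A\cdot B := \{ab : a\in A, b\in B\}$; $r\cdot A := \{ra : a\in A\}$ and $A\cdot r := \{ar : a \in A\}$ for a ring element $r$. $|A|$ denotes the cardinality of a finite set $A$. $X \ll Y$ means $X \leq CY$ for some absolute constant $C$; $O(1)$ denotes a quantity bounded by an absolute constant. $\mathbf{O}(N)$ denotes an unspecified finite non-empty subset of the ring of cardinality $O(N)$; thus $A \subset a\cdot S + \mathbf{O}(K^{O(1)})$ means that there is a finite non-empty set $X \subset R$ with $|X| \leq C K^{C}$, $C$ an absolute constant, such that $A \subset a\cdot S + X$. All implied constants are absolute (independent of $k$, the $D_i$, $A$, $K$). *)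

(* Defs.v *)
From HB Require Import structures.
From mathcomp Require Import all_boot all_order all_algebra finmap reals.
Set Implicit Arguments.
Unset Strict Implicit.
Unset Printing Implicit Defensive.
Import GRing.Theory.
Local Open Scope ring_scope.

(* The library provides a ring structure on {ffun I -> R} only, where all the
   factors are equal.  The product ring need not be nontrivial, as I may be
   empty. *)
Section ProductRing.
Variables (I : finType) (D : I -> pzRingType).
Implicit Types x y z : {dffun forall j : I, D j}.

Definition dffun_zero : {dffun forall j : I, D j} := [ffun j => 0].
Definition dffun_one : {dffun forall j : I, D j} := [ffun j => 1].
Definition dffun_opp x : {dffun forall j : I, D j} := [ffun j => - x j].
Definition dffun_add x y : {dffun forall j : I, D j} := [ffun j => x j + y j].
Definition dffun_mul x y : {dffun forall j : I, D j} := [ffun j => x j * y j].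

Fact dffun_addA : associative dffun_add.
Proof. by move=> x y z; apply/ffunP => j; rewrite !ffunE addrA. Qed.
Fact dffun_addC : commutative dffun_add.
Proof. by move=> x y; apply/ffunP => j; rewrite !ffunE addrC. Qed.
Fact dffun_add0 : left_id dffun_zero dffun_add.
Proof. by move=> x; apply/ffunP => j; rewrite !ffunE add0r. Qed.
Fact dffun_addN : left_inverse dffun_zero dffun_opp dffun_add.
Proof. by move=> x; apply/ffunP => j; rewrite !ffunE addNr. Qed.
Fact dffun_mulA : associative dffun_mul.
Proof. by move=> x y z; apply/ffunP => j; rewrite !ffunE mulrA. Qed.
Fact dffun_mul1l : left_id dffun_one dffun_mul.
Proof. by move=> x; apply/ffunP => j; rewrite !ffunE mul1r. Qed.
Fact dffun_mul1r : right_id dffun_one dffun_mul.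
Proof. by move=> x; apply/ffunP => j; rewrite !ffunE mulr1. Qed.
Fact dffun_mulDl : left_distributive dffun_mul dffun_add.
Proof. by move=> x y z; apply/ffunP => j; rewrite !ffunE mulrDl. Qed.
Fact dffun_mulDr : right_distributive dffun_mul dffun_add.
Proof. by move=> x y z; apply/ffunP => j; rewrite !ffunE mulrDr. Qed.

HB.instance Definition _ := GRing.isPzRing.Build {dffun forall j : I, D j}
  dffun_addA dffun_addC dffun_add0 dffun_addN dffun_mulA
  dffun_mul1l dffun_mul1r dffun_mulDl dffun_mulDr.

Lemma dffun_addE x y j : (x + y) j = x j + y j.
Proof. exact: ffunE. Qed.
Lemma dffun_mulE x y j : (x * y) j = x j * y j.
Proof. exact: ffunE. Qed.

End ProductRing.

Definition division_ring (D : unitRingType) : Prop :=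
  forall x : D, x != 0 -> x \is a GRing.unit.

Section SetArithmetic.
Variable R : pzRingType.
Implicit Types (A B S : {fset R}) (r : R).

Definition sumset A B : {fset R} := [fset (a + b)%R | a in A, b in B]%fset.
Definition prodset A B : {fset R} := [fset (a * b)%R | a in A, b in B]%fset.
Definition ldilate r A : {fset R} := [fset (r * a)%R | a in A]%fset.
Definition rdilate A r : {fset R} := [fset (a * r)%R | a in A]%fset.

Definition nonunital_subring S : Prop :=
  GRing.zmod_closed [in S] /\ GRing.mulr_2closed [in S].

(* GRing.unit is available on nontrivial rings only. *)
Definition invertible r : Prop := exists s : R, r * s = 1 /\ s * r = 1.

End SetArithmetic.

Definition proj (I : finType) (D : I -> pzRingType) (j : I)
  (x : {dffun forall i : I, D i}) : D j := x j.

(* Main.v *)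
(* Put H = A - A and call r an n-multiplier when rH is covered by L^n translates
   of H, where L is about K.  Multipliers are closed under +, * and inverses, up
   to an increase of n.  A Katz-Tao argument gives an invertible x in A and a
   large Y in A such that few translates of xH cover yA for y in Y, so that all
   x^-1 (y - y') are multipliers of bounded level.  If r is an n-multiplier, then
   |Y + rY| is small, hence y1 + r y2 = y3 + r y4 has so many solutions in Y that
   one of them has y2 - y4 invertible: coordinatewise, few pairs in A x A agree,
   since the projections of A are large.  Thus r = (y3 - y1) (y2 - y4)^-1, and
     x^-1 r x = (x^-1 (y3 - y1)) (x^-1 (y2 - y4))^-1
   is a multiplier of a level that does not depend on n.  As conjugation by x is
   injective and there are finitely many n-multipliers, the set S of multipliers
   of that level is invariant under conjugation and contains all multipliers of
   somewhat higher level; so S is a subring, and xS contains Y - Y. *)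
Require Import Defs.
From mathcomp Require Import all_boot all_order all_algebra finmap reals.
From mathcomp Require Import boolp zify.
Set Implicit Arguments.
Unset Strict Implicit.
Unset Printing Implicit Defensive.
Import Order.TTheory GRing.Theory Num.Theory.
Local Open Scope fset_scope.
Local Open Scope ring_scope.

(** * Cauchy-Schwarz and the counting of collisions *)

Lemma leq_size_inj (T U : eqType) (f : T -> U) (s : seq T) (t : seq U) :
  uniq s -> {in s &, injective f} -> {in s, forall x, f x \in t} ->
  (size s <= size t)%N.
Proof.
move=> us injf sub; rewrite -(size_map f); apply: uniq_leq_size.
  by rewrite map_inj_in_uniq.
by move=> _ /mapP[x xs ->]; apply: sub.
Qed.

Lemma card_fset_filter (T : choiceType) (A : {fset T}) (P : pred T) :
  #|` [fset x in A | P x]| = (\sum_(x <- A) P x)%N.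
Proof.
by rewrite card_fset_sum1 big_fset /= big_mkcond; apply: eq_bigr => x _; case: (P x).
Qed.

Lemma sum_eq_leq1 (T : choiceType) (U : eqType) (A : {fset T}) (f : T -> U) u :
  {in A &, injective f} -> (\sum_(x <- A) (f x == u) <= 1)%N.
Proof.
move=> injf; rewrite -card_fset_filter; set F := [fset _ in _ | _].
have [->|[x xF]] := fset_0Vmem F; first by rewrite cardfs0.
rewrite -(cardfs1 x); apply/fsubset_leq_card/fsubsetP => y.
move: xF; rewrite !inE /= => /andP[xA /eqP fx] /andP[yA /eqP fy].
by apply/eqP/injf => //; rewrite fx fy.
Qed.

(** Cauchy-Schwarz: twice the right-hand side is a double sum of [c u ^ 2 + c v ^ 2], compared term
    by term with [2 * (c u * c v)]. *)
Lemma sqr_sum_leq (T : Type) (s : seq T) (c : T -> nat) :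
  ((\sum_(v <- s) c v) ^ 2 <= size s * \sum_(v <- s) c v ^ 2)%N.
Proof.
have E1 : (size s * \sum_(v <- s) c v ^ 2 =
           \sum_(u <- s) \sum_(v <- s) c v ^ 2)%N.
  by rewrite big_const_seq count_predT iter_addn_0 mulnC.
have E2 : (size s * \sum_(v <- s) c v ^ 2 =
           \sum_(u <- s) \sum_(v <- s) c u ^ 2)%N.
  by rewrite E1 exchange_big.
rewrite -(leq_pmul2l (ltn0Sn 1)) [X in (_ <= X)%N]mul2n -addnn {1}E2 E1.
rewrite -mulnn big_distrl -big_split big_distrr /=; apply: leq_sum => u _.
rewrite big_distrr big_distrr -big_split /=; apply: leq_sum => v _.
exact: nat_Cauchy.
Qed.

(** Cauchy-Schwarz for the fibre sizes [c v]: they sum to [size s], and their squares count the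
    pairs with equal image. *)
Lemma collision_leq (T : Type) (U : eqType) (f : T -> U) (s : seq T) (V : seq U) :
  uniq V -> all (fun x => f x \in V) s ->
  (size s ^ 2 <= size V * \sum_(x <- s) \sum_(y <- s) (f x == f y))%N.
Proof.
move=> uV fV.
have pick1 u : u \in V -> (\sum_(v <- V) (u == v) = 1)%N.
  move=> uinV; rewrite (bigD1_seq u) //= eqxx big1 // => v /negPf vu.
  by rewrite eq_sym vu.
have all_big (F G : T -> nat) : (forall x, f x \in V -> F x = G x) ->
    (\sum_(x <- s) F x = \sum_(x <- s) G x)%N.
  move=> FG; elim: s fV => [|x s' IH] /=; first by rewrite !big_nil.
  by case/andP=> fx /IH; rewrite !big_cons (FG _ fx) => ->.
pose c v := (\sum_(x <- s) (f x == v))%N.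
have -> : size s = (\sum_(v <- V) c v)%N.
  rewrite exchange_big /= -sum1_size.
  by apply: (all_big) => x fx; rewrite pick1.
have -> : (\sum_(x <- s) \sum_(y <- s) (f x == f y) = \sum_(v <- V) c v ^ 2)%N.
  rewrite (eq_bigr (fun v => \sum_(x <- s) \sum_(y <- s) (f x == v) * (f y == v)))%N.
    rewrite [RHS]exchange_big /=; apply: (all_big) => x fx.
    rewrite [RHS]exchange_big /=; apply: (all_big) => y fy.
    rewrite (bigD1_seq (f x)) //= eqxx mul1n big1 ?addn0 => [|v /negPf vu].
      by rewrite eq_sym.
    by rewrite [f x == v]eq_sym vu.
  move=> v _; rewrite -mulnn big_distrl /=; apply: eq_bigr => x _.
  by rewrite big_distrr.
exact: sqr_sum_leq.
Qed.

(** A small image [V] forces high energy; used for [a + r * b] and for [a * b]. *)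
Lemma collision2_leq (S T U : choiceType) (f : S -> T -> U)
    (A : {fset S}) (B : {fset T}) (V : {fset U}) :
  (forall a b, a \in A -> b \in B -> f a b \in V) ->
  ((#|` A| * #|` B|) ^ 2 <= #|` V| *
     \sum_(a <- A) \sum_(b <- B) \sum_(a' <- A) \sum_(b' <- B)
        (f a b == f a' b'))%N.
Proof.
move=> fV; pose s := [seq (a, b) | a <- A, b <- B].
have := @collision_leq _ _ (fun p => f p.1 p.2) s V (fset_uniq _).
rewrite size_allpairs big_allpairs /=.
under eq_bigr do under eq_bigr do rewrite big_allpairs /=.
apply; apply/allP => _ /allpairsP[[a b] [aA bB ->]] /=.
exact: fV.
Qed.

(** * Sums and dilates of finite sets *)

Local Notation "A :+: B" := (sumset A B) (at level 50, left associativity).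
Local Notation "r :*: A" := (ldilate r A) (at level 40).
Local Notation "A :-: B" := (sumset A (ldilate (-1) B))
  (at level 50, left associativity).

Section Sumsets.
Variable R : pzRingType.
Implicit Types (A B C F G H X Y Z : {fset R}) (a b r s x y z : R) (m n : nat).

Lemma sumsetP A B z :
  reflect (exists a b, [/\ a \in A, b \in B & z = a + b]) (z \in A :+: B).
Proof.
rewrite /sumset; apply: (iffP (imfset2P _ _ _ _ _)).
  by move=> [a aA [b bB ->]]; exists a, b.
move=> [a [b [aA bB ->]]].
by exists a => //; exists b.
Qed.

Lemma mem_sumset A B a b : a \in A -> b \in B -> a + b \in A :+: B.
Proof. by move=> aA bB; apply/sumsetP; exists a, b. Qed.

Lemma ldilateP r A z : reflect (exists2 a, a \in A & z = r * a) (z \in r :*: A).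
Proof. exact: imfsetP. Qed.

Lemma mem_ldilate r A a : a \in A -> r * a \in r :*: A.
Proof. by move=> aA; apply/ldilateP; exists a. Qed.

Lemma mem_diffset A B a b : a \in A -> b \in B -> a - b \in A :-: B.
Proof. by move=> aA bB; rewrite -mulN1r; exact/mem_sumset/mem_ldilate. Qed.

Lemma diffsetP A B z :
  reflect (exists a b, [/\ a \in A, b \in B & z = a - b]) (z \in A :-: B).
Proof.
apply: (iffP idP) => [/sumsetP[a [_ [aA /ldilateP[b bB ->] ->]]]|].
  by exists a, b; rewrite mulN1r.
by move=> [a [b [aA bB ->]]]; exact: mem_diffset.
Qed.

Lemma sumsetC A B : A :+: B = B :+: A.
Proof.
by apply/fsetP => z; apply/sumsetP/sumsetP => -[a [b [? ? ->]]];
  exists b, a; rewrite addrC.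
Qed.

Lemma sumsetA A B C : A :+: (B :+: C) = A :+: B :+: C.
Proof.
apply/fsetP => z; apply/sumsetP/sumsetP.
  move=> [a [_ [aA /sumsetP[b [c [bB cC ->]]] ->]]].
  by exists (a + b), c; split; rewrite ?addrA // mem_sumset.
move=> [_ [c [/sumsetP[a [b [aA bB ->]]] cC ->]]].
by exists a, (b + c); split; rewrite ?addrA // mem_sumset.
Qed.

Lemma sumsetCA A B C : A :+: (B :+: C) = B :+: (A :+: C).
Proof. by rewrite !sumsetA (sumsetC A). Qed.

Lemma sumsetACA A B C X : (A :+: B) :+: (C :+: X) = (A :+: C) :+: (B :+: X).
Proof. by rewrite -!sumsetA (sumsetCA B). Qed.

Lemma sumset0r A : A :+: [fset 0] = A.
Proof.
apply/fsetP => z; apply/sumsetP/idP => [[a [b [aA]]]|zA].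
  by rewrite inE => /eqP -> ->; rewrite addr0.
by exists z, 0; rewrite inE eqxx addr0.
Qed.

Lemma sumsetSS A B C X : A `<=` B -> C `<=` X -> A :+: C `<=` B :+: X.
Proof.
move=> /fsubsetP AB /fsubsetP CX; apply/fsubsetP => _ /sumsetP[a [c [aA cC ->]]].
by apply: mem_sumset; [exact: AB | exact: CX].
Qed.

Lemma ldilateS r A B : A `<=` B -> r :*: A `<=` r :*: B.
Proof.
by move=> /fsubsetP AB; apply/fsubsetP => _ /ldilateP[a /AB aB ->]; exact: mem_ldilate.
Qed.

Lemma ldilateD r A B : r :*: (A :+: B) = r :*: A :+: r :*: B.
Proof.
apply/fsetP => z; apply/ldilateP/sumsetP.
  move=> [_ /sumsetP[a [b [aA bB ->]]] ->].
  by exists (r * a), (r * b); rewrite mulrDr !mem_ldilate.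
move=> [_ [_ [/ldilateP[a aA ->] /ldilateP[b bB ->] ->]]].
by exists (a + b); rewrite ?mulrDr ?mem_sumset.
Qed.

Lemma ldilateM r s A : r :*: (s :*: A) = (r * s) :*: A.
Proof.
apply/fsetP => z; apply/ldilateP/ldilateP.
  by move=> [_ /ldilateP[a aA ->] ->]; exists a; rewrite ?mulrA.
by move=> [a aA ->]; exists (s * a); rewrite ?mulrA ?mem_ldilate.
Qed.

Lemma ldilate1 A : 1 :*: A = A.
Proof.
apply/fsetP => z; apply/ldilateP/idP => [[a aA ->]|zA]; first by rewrite mul1r.
by exists z; rewrite ?mul1r.
Qed.

Lemma ldilateDl r s A : (r + s) :*: A `<=` r :*: A :+: s :*: A.
Proof.
by apply/fsubsetP => _ /ldilateP[a aA ->]; rewrite mulrDl mem_sumset ?mem_ldilate.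
Qed.

Lemma ldilate_neq0 r A : A != fset0 -> r :*: A != fset0.
Proof.
by case/fset0Pn=> a aA; apply/fset0Pn; exists (r * a); exact: mem_ldilate.
Qed.

Lemma sumset_neq0 A B : A != fset0 -> B != fset0 -> A :+: B != fset0.
Proof.
move=> /fset0Pn[a aA] /fset0Pn[b bB]; apply/fset0Pn.
by exists (a + b); exact: mem_sumset.
Qed.

Lemma opp_diffset A : (-1) :*: (A :-: A) = A :-: A.
Proof. by rewrite ldilateD ldilateM mulrNN mulr1 ldilate1 sumsetC. Qed.

Lemma card_sumset_leq A B : (#|` A :+: B| <= #|` A| * #|` B|)%N.
Proof.
rewrite -(size_allpairs (fun a b => a + b)); apply: uniq_leq_size => // z.
by move=> /sumsetP[a [b [aA bB ->]]]; apply/allpairsP; exists (a, b).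
Qed.

Lemma card_ldilate_leq r A : (#|` r :*: A| <= #|` A|)%N.
Proof. exact: leq_imfset_card. Qed.

Lemma card_translate A x : #|` A :+: [fset x]| = #|` A|.
Proof.
apply/eqP; rewrite eqn_leq; apply/andP; split.
  by apply: leq_trans (card_sumset_leq _ _) _; rewrite cardfs1 muln1.
apply: (@leq_size_inj _ _ (fun a => a + x)) => [|a b _ _ /addIr//|].
  exact: fset_uniq.
by move=> a aA; apply: mem_sumset; rewrite ?inE.
Qed.

Lemma leq_card_sumset A B : B != fset0 -> (#|` A| <= #|` A :+: B|)%N.
Proof.
case/fset0Pn=> b bB; rewrite -(card_translate A b).
by apply/fsubset_leq_card/sumsetSS; rewrite ?fsub1set.
Qed.

(** * Ruzsa's triangle inequality and Petridis's approach to Pluennecke's inequality *)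

(** Fix a representation d = a - b of every difference. The map from (d, x) to (a + x, b + x) is
    injective: the two coordinates differ by d, which gives back the representation and then x. *)
Lemma ruzsa_triangle A B X :
  (#|` A :-: B| * #|` X| <= #|` A :+: X| * #|` B :+: X|)%N.
Proof.
have [f fP] : {f : R -> R * R | forall d, d \in A :-: B ->
    [/\ (f d).1 \in A, (f d).2 \in B & d = (f d).1 - (f d).2]}.
  have /choice[f fP] : forall d, exists p : R * R, d \in A :-: B ->
      [/\ p.1 \in A, p.2 \in B & d = p.1 - p.2].
    move=> d; case: (boolP (d \in A :-: B)) => [/diffsetP[a [b abP]]|].
      by exists (a, b).
    by exists (0, 0).
  by exists f.
rewrite -!(size_allpairs pair).
apply: (@leq_size_inj _ _ (fun p => ((f p.1).1 + p.2, (f p.1).2 + p.2))).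
- by apply: allpairs_uniq => [||[? ?] [? ?] _ _ /= [-> ->]//]; exact: fset_uniq.
- move=> _ _ /allpairsP[[d x] [/= /fP[_ _ dE] xX ->]]
    /allpairsP[[e y] [/= /fP[_ _ eE] yX ->]] /= [E1 E2].
  have shift (p q z : R) : p - q = (p + z) - (q + z).
    by rewrite opprD addrACA subrr addr0.
  have de : d = e by rewrite dE eE (shift _ _ x) E1 E2 -shift.
  by move: E1; rewrite de => /addrI ->.
- move=> _ /allpairsP[[d x] [/= /fP[fA fB _] xX ->]] /=.
  by apply/allpairsP; eexists (_, _); split; [| |reflexivity]; exact: mem_sumset.
Qed.

(** The hypothesis says that [X] minimises |A + Z| / |Z| over its non-empty subsets. In the
    induction on [C], it is applied to the set [Z] of those x in [X] for which A + x + c brings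
    nothing new. *)
Lemma petridis_inequality A X C :
  X != fset0 ->
  (forall Z, Z `<=` X -> (#|` A :+: X| * #|` Z| <= #|` A :+: Z| * #|` X|)%N) ->
  (#|` A :+: X :+: C| * #|` X| <= #|` A :+: X| * #|` X :+: C|)%N.
Proof.
move=> X0 minX; elim/finSet_rect: C => C IH.
have [->|[c cC]] := fset_0Vmem C.
  suff -> : A :+: X :+: fset0 = fset0 by rewrite cardfs0.
  by apply/fsetP => z; rewrite in_fset0; apply/negbTE/negP => /sumsetP[? [? []]].
set C' := C `\ c.
have /IH {}IH : C' `<` C by rewrite fproperD1.
have CE : C = c |` C' by rewrite fsetD1K.
(* Passing from C' to C adds at most |A + X| - |A + Z| elements to A + X + C'
   and at least |X| - |Z| elements to X + C'. *)
pose Z := [fset x in X | A :+: [fset (x + c)] `<=` A :+: X :+: C'].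
have ZX : Z `<=` X by apply/fsubsetP => x; rewrite !inE => /andP[].
have up : (#|` A :+: X :+: C| + #|` A :+: Z| <= #|` A :+: X :+: C'| + #|` A :+: X|)%N.
  have sub : A :+: X :+: C `<=` (A :+: X :+: C') `|`
      ((A :+: X :+: [fset c]) `\` (A :+: Z :+: [fset c])).
    apply/fsubsetP => _ /sumsetP[u [d [uAX dC ->]]].
    rewrite in_fsetU in_fsetD; case: (boolP (u + d \in A :+: X :+: C')) => //= nin.
    move: dC nin; rewrite CE in_fset1U => /orP[/eqP ->|dC']; last by rewrite mem_sumset.
    move=> nin; apply/andP; split; last by rewrite mem_sumset ?inE.
    apply: contra nin => /sumsetP[_ [b [/sumsetP[a [z [aA zZ ->]]]]]].
    rewrite inE => /eqP -> ->; move: zZ; rewrite !inE => /andP[zX /fsubsetP]; apply.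
    by rewrite -addrA mem_sumset // inE.
  have ZcX : A :+: Z :+: [fset c] `<=` A :+: X :+: [fset c].
    by rewrite !sumsetSS.
  move/fsubset_leq_card: sub.
  rewrite -(card_translate (A :+: Z) c) -(card_translate (A :+: X) c).
  have := cardfsDS ZcX; have := fsubset_leq_card ZcX.
  have := cardfsUI (A :+: X :+: C') ((A :+: X :+: [fset c]) `\` (A :+: Z :+: [fset c])).
  lia.
have low : (#|` X :+: C'| + #|` X| <= #|` X :+: C| + #|` Z|)%N.
  have sub : (X :+: C') `|` (X :+: [fset c]) `<=` X :+: C.
    by rewrite fsubUset !sumsetSS // ?fsubD1set ?fsub1set // /C' fsubD1set.
  (* If x + c lies in X + C', then A + x + c lies in A + X + C', so x is in [Z]. *)
  have inter : (X :+: C') `&` (X :+: [fset c]) `<=` Z :+: [fset c].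
    apply/fsubsetP => w; rewrite in_fsetI => /andP[wXC /sumsetP[x [b [xX]]]].
    rewrite inE => /eqP -> wE; rewrite wE; apply: mem_sumset; rewrite !inE //.
    rewrite xX /=; apply/fsubsetP => _ /sumsetP[a [b' [aA /fset1P -> ->]]].
    by rewrite -wE -sumsetA mem_sumset.
  move/fsubset_leq_card: inter; rewrite card_translate.
  move/fsubset_leq_card: sub.
  have := cardfsUI (X :+: C') (X :+: [fset c]); rewrite card_translate.
  lia.
have := minX Z ZX; move: IH up low.
set p := #|` A :+: X :+: C|; set p' := #|` A :+: X :+: C'|; set q := #|` A :+: X|.
set u := #|` X :+: C|; set u' := #|` X :+: C'|.
set z := #|` Z|; set w := #|` A :+: Z|; set xx := #|` X|.
nia.
Qed.

(** If [B] is not minimal itself, some proper subset [Z] has a strictly smaller ratio, and induction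
    applies to [Z]. *)
Lemma petridis_minimizer A B :
  B != fset0 ->
  exists X, [/\ X != fset0, X `<=` B,
    (#|` A :+: X| * #|` B| <= #|` A :+: B| * #|` X|)%N &
    forall Z, Z `<=` X -> (#|` A :+: X| * #|` Z| <= #|` A :+: Z| * #|` X|)%N].
Proof.
elim/finSet_rect: B => B IH B0.
have [minB|] := pselect (forall Z, Z `<=` B ->
    (#|` A :+: B| * #|` Z| <= #|` A :+: Z| * #|` B|)%N); first by exists B.
move=> /existsNP[Z /not_implyP[ZB /negP]]; rewrite -ltnNge => ltZB.
have Z0 : Z != fset0 by rewrite -cardfs_gt0; move: ltZB; nia.
have [|X [X0 XZ leX minX]] := IH Z _ Z0.
  rewrite fproperEneq ZB andbT; apply/eqP => ZE; by rewrite ZE ltnn in ltZB.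
exists X; split => //; first exact: fsubset_trans ZB.
move: (ltnW ltZB) leX Z0; rewrite -cardfs_gt0.
move: #|` A :+: X| #|` A :+: B| #|` A :+: Z| #|` B| #|` X| #|` Z|.
move=> ax ab az b x z H1 H2 z0; rewrite -(leq_pmul2r z0).
apply: (@leq_trans (az * x * b)); first by nia.
nia.
Qed.

(** Pluennecke's inequality in a form that can be iterated: [X] does not depend on [C], so each
    further summand [A] costs one factor [L] once [X] is among the summands. *)
Lemma doubling_growth A (L : nat) :
  A != fset0 -> (#|` A :+: A| <= L * #|` A|)%N ->
  exists X, [/\ X != fset0, X `<=` A &
    forall C, (#|` X :+: C :+: A| <= L * #|` X :+: C|)%N].
Proof.
move=> A0 dblA; have [X [X0 XA leX minX]] := petridis_minimizer A A0.
exists X; split => // C; rewrite sumsetC sumsetA.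
have := petridis_inequality C X0 minX; move: leX dblA X0 A0; rewrite -!cardfs_gt0.
move: #|` A :+: X :+: C| #|` A :+: X| #|` A :+: A| #|` A| #|` X| #|` X :+: C|.
move=> axc ax aa a x xc H1 H2 x0 a0 H3.
rewrite -(leq_pmul2r a0) -(leq_pmul2r x0).
have := leq_mul H3 (leqnn a); have := leq_mul H1 (leqnn xc).
have := leq_mul H2 (leqnn (x * xc)); lia.
Qed.

(** Iterated growth bounds the sum of [X] and m copies of [A] by L^m |X|; the triangle inequality
    with pivot [X] then gives |mA - nA| <= L^(m+n) |A|. *)
Lemma doubling_bounds A (L : nat) :
  A != fset0 -> (#|` A :+: A| <= L * #|` A|)%N ->
  [/\ (#|` A :+: (A :-: A)| <= L ^ 3 * #|` A|)%N,
      (#|` (A :-: A) :+: (A :-: A)| <= L ^ 4 * #|` A|)%N &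
      (#|` (A :-: A) :+: (A :-: A) :+: A| <= L ^ 5 * #|` A|)%N].
Proof.
move=> A0 /(doubling_growth A0)[X [X0 XA growth]].
have X1 : (#|` A :+: X| <= L * #|` X|)%N.
  by have := growth [fset 0]; rewrite !sumset0r sumsetC.
have X2 : (#|` A :+: A :+: X| <= L ^ 2 * #|` X|)%N.
  rewrite (sumsetC (A :+: A)) sumsetA; apply: leq_trans (growth A) _.
  by rewrite expnS -mulnA leq_mul // expn1 sumsetC.
have X3 : (#|` A :+: A :+: A :+: X| <= L ^ 3 * #|` X|)%N.
  rewrite (sumsetC (A :+: A :+: A)) sumsetA; apply: leq_trans (growth _) _.
  by rewrite expnS -mulnA leq_mul // sumsetC.
have tri B C m n : (#|` B :+: X| <= L ^ m * #|` X|)%N ->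
    (#|` C :+: X| <= L ^ n * #|` X|)%N -> (#|` B :-: C| <= L ^ (m + n) * #|` A|)%N.
  move=> BX CX; apply: (@leq_trans (L ^ (m + n) * #|` X|)); last first.
    by rewrite leq_mul // fsubset_leq_card.
  rewrite -(leq_pmul2r (_ : 0 < #|` X|)%N) ?cardfs_gt0 //.
  apply: leq_trans (ruzsa_triangle _ _ _) _.
  by rewrite expnD -mulnA mulnACA leq_mul.
split.
- by rewrite sumsetA (tri _ _ 2 1) // expn1.
- by rewrite sumsetACA -ldilateD (tri _ _ 2 2).
- by rewrite sumsetC sumsetACA -ldilateD !sumsetA (tri _ _ 3 2).
Qed.

(** * Covering by translates *)

(** [X] lies in at most [m] translates of [Y]. Unlike a bound on cardinalities, this relation
    composes and passes to sums and dilates. *)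
Definition coverable (m : nat) (X Y : {fset R}) : Prop :=
  exists2 F : {fset R}, (#|` F| <= m)%N & X `<=` F :+: Y.

Lemma coverableS m X X' Y : X `<=` X' -> coverable m X' Y -> coverable m X Y.
Proof. by move=> XX' [F Fm sub]; exists F => //; exact: fsubset_trans sub. Qed.

Lemma coverable_sumset m n X X' Y Y' :
  coverable m X Y -> coverable n X' Y' -> coverable (m * n) (X :+: X') (Y :+: Y').
Proof.
move=> [F Fm sub] [F' Fn sub']; exists (F :+: F').
  by apply: leq_trans (card_sumset_leq _ _) _; exact: leq_mul.
by rewrite sumsetACA sumsetSS.
Qed.

Lemma coverable_trans m n X Y Z :
  coverable m X Y -> coverable n Y Z -> coverable (m * n) X Z.
Proof.
move=> [F Fm sub] [F' Fn sub']; exists (F :+: F').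
  by apply: leq_trans (card_sumset_leq _ _) _; exact: leq_mul.
by apply: fsubset_trans sub _; rewrite -sumsetA sumsetSS.
Qed.

Lemma coverable_ldilate m r X Y :
  coverable m X Y -> coverable m (r :*: X) (r :*: Y).
Proof.
move=> [F Fm sub]; exists (r :*: F); first exact: leq_trans (card_ldilate_leq _ _) _.
by rewrite -ldilateD ldilateS.
Qed.

Lemma card_coverable m X Y Z :
  coverable m X Y -> (#|` Z :+: X| <= m * #|` Z :+: Y|)%N.
Proof.
move=> [F Fm sub]; apply: (@leq_trans (#|` F :+: (Z :+: Y)|)).
  by apply: fsubset_leq_card; rewrite sumsetCA sumsetSS.
by apply: leq_trans (card_sumset_leq _ _) _; rewrite leq_mul.
Qed.

(** A maximal family of disjoint translates f + Z with f in [B], built greedily; disjointness is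
    expressed by |F + Z| = |F| |Z|. If b + Z meets f + Z, then b lies in f + Z - Z. *)
Lemma disjoint_translates B Z : Z != fset0 ->
  exists F, [/\ F `<=` B, #|` F :+: Z| = (#|` F| * #|` Z|)%N &
                B `<=` F :+: (Z :-: Z)].
Proof.
move=> /fset0Pn[z zZ]; elim/finSet_rect: B => B IH.
have [->|[b bB]] := fset_0Vmem B.
  exists fset0; rewrite !fsub0set cardfs0 mul0n; split => //.
  by apply/eqP; rewrite -leqn0; apply: leq_trans (card_sumset_leq _ _) _; rewrite cardfs0.
have /IH[F [FB cardF sub]] : B `\ b `<` B by rewrite fproperD1.
have {}FB := fsubset_trans FB (fsubD1set _ _).
have split_B (G : {fset R}) : F :+: (Z :-: Z) `<=` G -> b \in G -> B `<=` G.
  move=> FG bG; apply/fsubsetP => x xB; have [->//|xb] := eqVneq x b.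
  by apply: (fsubsetP FG); apply: (fsubsetP sub); rewrite !inE xb.
have [bF|bNF] := boolP (b \in F :+: (Z :-: Z)).
  by exists F; split => //; apply: split_B.
exists (b |` F); split.
- by rewrite fsubUset fsub1set bB.
- have -> : (b |` F) :+: Z = (Z :+: [fset b]) `|` (F :+: Z).
    apply/fsetP => x; rewrite in_fsetU; apply/sumsetP/orP.
      move=> [y [w [/fset1UP[->|yF] wZ ->]]].
        by left; rewrite addrC mem_sumset ?inE.
      by right; rewrite mem_sumset.
    case=> [/sumsetP[y [w [yZ /fset1P -> ->]]]|/sumsetP[y [w [yF wZ ->]]]].
      by exists b, y; rewrite !inE eqxx yZ addrC.
    by exists y, w; rewrite !inE yF orbT.
  rewrite cardfsU card_translate cardF.
  have -> : (Z :+: [fset b]) `&` (F :+: Z) = fset0.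
    apply/eqP/fset0Pn => -[x]; rewrite inE => /andP[/sumsetP[y [_ [yZ /fset1P -> ->]]]].
    move=> /sumsetP[f [w [fF wZ E]]]; case/negP: bNF.
    have -> : b = f + (w - y) by rewrite addrA -E [y + b]addrC addrK.
    by rewrite mem_sumset // mem_diffset.
  have bF : b \notin F.
    by apply: contra bNF => bF; rewrite -[b]addr0 -(subrr z) mem_sumset // mem_diffset.
  by rewrite cardfs0 subn0 cardfsU1 bF mulnDl mul1n.
- apply: split_B.
    by rewrite sumsetSS // fsubsetU1.
  by rewrite -[X in X \in _]addr0 -(subrr z) mem_sumset ?mem_diffset // !inE eqxx.
Qed.

(** The disjoint translates lie in B + Z, so there are at most [m] of them. *)
Lemma ruzsa_covering m B Z :
  Z != fset0 -> (#|` B :+: Z| <= m * #|` Z|)%N ->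
  exists F, [/\ F `<=` B, (#|` F| <= m)%N & B `<=` F :+: (Z :-: Z)].
Proof.
move=> Z0 BZ; have [F [FB cardF sub]] := disjoint_translates B Z0.
exists F; split => //; rewrite -(leq_pmul2r (_ : 0 < #|` Z|)%N) ?cardfs_gt0 //.
rewrite -cardF; apply: leq_trans BZ.
by rewrite fsubset_leq_card // sumsetSS.
Qed.

Lemma ruzsa_coverable m B Z :
  Z != fset0 -> (#|` B :+: Z| <= m * #|` Z|)%N -> coverable m B (Z :-: Z).
Proof. by move=> Z0 /(ruzsa_covering Z0)[F [_ Fm sub]]; exists F. Qed.

(** * Invertible elements and the algebra of multipliers *)

Lemma invertibleN r : invertible (- r) -> invertible r.
Proof.
move=> [s [rs sr]]; exists (- s).
by split; [rewrite mulrN -mulNr | rewrite mulNr -mulrN].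
Qed.

Lemma invertible_lreg r : invertible r -> injective (fun x => r * x).
Proof.
by move=> [s [_ sr]] x y /(congr1 ( *%R s)); rewrite !mulrA sr !mul1r.
Qed.

Lemma invertible_rreg r : invertible r -> injective (fun x => x * r).
Proof.
by move=> [s [rs _]] x y /(congr1 ( *%R^~ s)); rewrite -!mulrA rs !mulr1.
Qed.

Lemma sum_nat_leq_const (T : choiceType) (X : {fset T}) (f : T -> nat) m :
  {in X, forall t : T, f t <= m}%N -> (\sum_(t <- X) f t <= #|` X| * m)%N.
Proof.
move=> fm; rewrite card_fset_sum1 big_distrl /= big_seq [X in (_ <= X)%N]big_seq.
by apply: leq_sum => t /fm; rewrite mul1n.
Qed.

Section Multipliers.
Variables (A : {fset R}) (L : nat).
Hypotheses (A0 : A != fset0) (L1 : (1 < L)%N).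
Hypothesis dblA : (#|` A :+: A| <= L * #|` A|)%N.
Let H := A :-: A.
Let L0 : (0 < L)%N := ltnW L1.

Definition multiplier n r : Prop := coverable (L ^ n) (r :*: H) H.

Let H0 : H != fset0. Proof. by rewrite sumset_neq0 ?ldilate_neq0. Qed.

(** The source of every summand 5 in the levels: |H + H + A| <= L^5 |A|. *)
Let cover_2H : coverable (L ^ 5) (H :+: H) H.
Proof. by apply: ruzsa_coverable => //; have [] := doubling_bounds A0 dblA. Qed.

Lemma multiplierN n r : multiplier n r -> multiplier n (- r).
Proof. by rewrite /multiplier -mulrN1 -ldilateM opp_diffset. Qed.

Lemma multiplierD n r s :
  multiplier n r -> multiplier n s -> multiplier (n + n + 5) (r + s).
Proof.
move=> rP sP; apply: coverableS (ldilateDl _ _ _) _.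
by rewrite /multiplier !expnD; apply: coverable_trans cover_2H; exact: coverable_sumset.
Qed.

Lemma multiplierM m n r s :
  multiplier m r -> multiplier n s -> multiplier (n + m) (r * s).
Proof.
move=> rP sP; rewrite /multiplier expnD -ldilateM.
by apply: coverable_trans rP; exact: coverable_ldilate.
Qed.

Lemma coverable_multiplier n r :
  coverable (L ^ n) (r :*: A) H -> multiplier (n + n + 5) r.
Proof.
move=> rA; rewrite /multiplier !expnD; apply: coverable_trans cover_2H.
rewrite ldilateD; apply: coverable_sumset => //.
rewrite ldilateM mulrN1 -mulN1r -ldilateM -[X in coverable _ _ X]opp_diffset.
exact: coverable_ldilate.
Qed.

(** sH + H = s(H + rH) has at most L^n |H + H| elements, so sH is covered by L^(n+4) translates of H
    - H = H + H. *)
Lemma multiplierV n r s :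
  r * s = 1 -> s * r = 1 -> multiplier n r -> multiplier (n + 4 + 5) s.
Proof.
move=> rs sr rP; rewrite /multiplier expnD; apply: coverable_trans cover_2H.
rewrite -[X in _ :+: X]opp_diffset; apply: ruzsa_coverable => //.
have -> : s :*: H :+: H = s :*: (H :+: r :*: H).
  by rewrite ldilateD ldilateM sr ldilate1.
apply: leq_trans (card_ldilate_leq _ _) _.
apply: leq_trans (card_coverable H rP) _; rewrite expnD -mulnA leq_mul //.
have [_ H2 _] := doubling_bounds A0 dblA; apply: leq_trans H2 _.
by rewrite leq_mul // leq_card_sumset ?ldilate_neq0.
Qed.

(** In a product of division rings these are the b that agree with [v] in some coordinate. *)
Definition singular v := [fset b in A | ~~ `[< invertible (v - b) >]].

(** * Multipliers as ratios of differences *)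

Section Popularity.
Variable Y : {fset R}.
Hypotheses (YA : Y `<=` A) (denseY : (#|` A| <= L ^ 3 * #|` Y|)%N).

Let Y_gt0 : (0 < #|` Y|)%N.
Proof.
move: denseY A0; rewrite -cardfs_gt0; case: #|` Y| => //.
by rewrite muln0; case: #|` A|.
Qed.

(** The solutions of a + r b = c + r d in [Y] that determine r, as (c - a) (b - d)^-1. *)
Definition ratio_count r := (\sum_(a <- Y) \sum_(b <- Y) \sum_(c <- Y) \sum_(d <- Y)
  (`[< invertible (b - d)%R >] && (a + r * b == c + r * d)%R))%N.

(** rY lies in a translate of rH, so |Y + rY| <= |A + rH| <= L^n |A + H|, and |A + H| <= L^3 |A| <=
    L^6 |Y|. *)
Lemma card_dilate_sum n r :
  multiplier n r -> (#|` Y :+: r :*: Y| <= L ^ (n + 6) * #|` Y|)%N.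
Proof.
move=> rP; have [a1 a1A] := fset0Pn _ A0.
have sub : r :*: Y `<=` r :*: H :+: [fset r * a1].
  apply/fsubsetP => _ /ldilateP[y /(fsubsetP YA) yA ->].
  by rewrite -[y](subrK a1) mulrDr mem_sumset ?inE // mem_ldilate // mem_diffset.
apply: (@leq_trans #|` A :+: r :*: H|).
  rewrite -[leqRHS](card_translate _ (r * a1)) -sumsetA.
  by apply: fsubset_leq_card; rewrite sumsetSS.
apply: leq_trans (card_coverable A rP) _.
have [A3 _ _] := doubling_bounds A0 dblA.
rewrite expnD -mulnA leq_mul //; apply: leq_trans A3 _.
by rewrite (expnD L 3 3) -mulnA leq_mul.
Qed.

(** Cauchy-Schwarz gives at least |Y|^3 / L^(n+6) solutions in all. Those with b - d not invertible
    number at most |Y|^3 / L^(n+7), which is at most half of this as L >= 2. *)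
Lemma ratio_count_lower n r :
  multiplier n r ->
  {in A, forall v, #|` singular v| * L ^ (n + 10) <= #|` A|}%N ->
  (#|` Y| ^ 3 <= L ^ (n + 7) * ratio_count r)%N.
Proof.
move=> rP sing.
pose E := (\sum_(a <- Y) \sum_(b <- Y) \sum_(c <- Y) \sum_(d <- Y)
  (a + r * b == c + r * d)%R)%N.
pose B := (\sum_(a <- Y) \sum_(b <- Y) \sum_(c <- Y) \sum_(d <- Y)
  (~~ `[< invertible (b - d)%R >] && (a + r * b == c + r * d)%R))%N.
have EGB : E = (ratio_count r + B)%N.
  rewrite /E /B /ratio_count -big_split; apply: eq_bigr => a _.
  rewrite -big_split /=; apply: eq_bigr => b _.
  rewrite -big_split /=; apply: eq_bigr => c _.
  rewrite -big_split /=; apply: eq_bigr => d _ /=.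
  by case: asboolP => /=; rewrite ?addn0.
have EY : (#|` Y| ^ 3 <= L ^ (n + 6) * E)%N.
  rewrite -(leq_pmul2r Y_gt0).
  have /leq_trans := @collision2_leq _ _ _ (fun a b => a + r * b) Y Y (Y :+: r :*: Y)
    (fun a b aY bY => mem_sumset aY (mem_ldilate r bY)).
  rewrite -expnSr mulnn -expnM; apply.
  by rewrite mulnAC; apply: leq_mul => //; exact: card_dilate_sum.
(* Choose a, b and then d in [singular b]: this determines c. The factor L^3 trades |A| for |Y|. *)
have BY : (B * L ^ (n + 7) <= #|` Y| ^ 3)%N.
  rewrite -(leq_pmul2r (_ : 0 < L ^ 3)%N) ?expn_gt0 ?L0 // -mulnA -expnD -addnA.
  apply: (@leq_trans (#|` Y| * (#|` Y| * #|` A|))); last first.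
    apply: leq_trans (leq_mul (leqnn _) (leq_mul (leqnn _) denseY)) _.
    by move: #|` Y| (L ^ 3)%N => y l; rewrite !expnS expn0; lia.
  rewrite /B big_distrl /=; apply: sum_nat_leq_const => a aY.
  rewrite big_distrl /=; apply: sum_nat_leq_const => b bY.
  apply: leq_trans (sing b (fsubsetP YA _ bY)); rewrite leq_mul //.
  apply: (@leq_trans #|` [fset d in Y | ~~ `[< invertible (b - d) >]]|); last first.
    apply/fsubset_leq_card/fsubsetP => d; rewrite !inE /= => /andP[dY ->].
    by rewrite (fsubsetP YA _ dY).
  rewrite card_fset_filter exchange_big /=; apply: leq_sum => d _.
  case: asboolP => _ /=; first by rewrite big1.
  under eq_bigr do rewrite eq_sym.
  by apply: sum_eq_leq1 => c c' _ _ /addIr.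
rewrite -(leq_add2r (#|` Y| ^ 3)) addnn -mul2n.
apply: (@leq_trans (L * #|` Y| ^ 3)); first by rewrite leq_mul.
apply: leq_trans (leq_mul (leqnn L) EY) _.
rewrite mulnA -expnS -addnS EGB mulnDr leq_add2l.
by rewrite mulnC.
Qed.

(** A quadruple with b - d invertible is counted for at most one r. *)
Lemma sum_ratio_count (T : {fset R}) :
  (\sum_(r <- T) ratio_count r <= #|` Y| ^ 4)%N.
Proof.
rewrite /ratio_count exchange_big /=.
rewrite !expnS expn0 muln1; apply: sum_nat_leq_const => a _.
rewrite exchange_big /=; apply: sum_nat_leq_const => b _.
rewrite exchange_big /=; apply: sum_nat_leq_const => c _.
rewrite exchange_big -[leqRHS]muln1 /=; apply: sum_nat_leq_const => d _.
case: asboolP => [bd|_]; last by rewrite big1.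
rewrite (eq_bigr (fun r => (r * (b - d) == c - a) : nat)) => [|r _].
  by apply: sum_eq_leq1 => x y _ _; exact: invertible_rreg.
congr nat_of_bool; rewrite mulrBr -[LHS]subr_eq0 -[RHS]subr_eq0; congr (_ == 0).
by rewrite opprB opprD addrACA addrC.
Qed.

Lemma ratio_count_gt0 r : (0 < ratio_count r)%N ->
  exists a b c d, [/\ a \in Y, b \in Y, c \in Y & d \in Y] /\
    invertible (b - d) /\ r * (b - d) = c - a.
Proof.
rewrite lt0n sum_nat_seq_neq0 => /hasP[a aY] /=.
rewrite sum_nat_seq_neq0 => /hasP[b bY] /=.
rewrite sum_nat_seq_neq0 => /hasP[c cY] /=.
rewrite sum_nat_seq_neq0 => /hasP[d dY] /=.
rewrite eqb0 negbK => /andP[/asboolP bd /eqP E].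
exists a, b, c, d; do 2!split => //; rewrite mulrBr; apply/eqP.
by rewrite subr_eq addrAC -E addrAC subrr add0r.
Qed.

(** Double counting: each r in [T] takes at least |Y|^3 / L^(n+7) of at most |Y|^4 quadruples. *)
Lemma card_multipliers n (T : {fset R}) :
  {in T, forall r, multiplier n r} ->
  {in A, forall v, #|` singular v| * L ^ (n + 10) <= #|` A|}%N ->
  (#|` T| <= L ^ (n + 7) * #|` Y|)%N.
Proof.
move=> TP sing; rewrite -(leq_pmul2r (_ : 0 < #|` Y| ^ 3)%N) ?expn_gt0 ?Y_gt0 //.
rewrite -mulnA -expnS; apply: leq_trans (leq_mul (leqnn _) (sum_ratio_count T)).
rewrite card_fset_sum1 big_distrl big_distrr /= big_seq [leqRHS]big_seq.
by apply: leq_sum => r /TP rP; rewrite mul1n ratio_count_lower.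
Qed.

(** The level n enters only through the hypotheses; the quadruple lies in [Y], which does not depend
    on n. *)
Lemma multiplier_ratio n r :
  multiplier n r ->
  {in A, forall v, #|` singular v| * L ^ (n + 10) <= #|` A|}%N ->
  exists a b c d, [/\ a \in Y, b \in Y, c \in Y & d \in Y] /\
    invertible (b - d) /\ r * (b - d) = c - a.
Proof.
move=> rP sing; apply: ratio_count_gt0.
have := ratio_count_lower rP sing; case: ratio_count => //.
by rewrite muln0 leqn0 expn_eq0 -leqn0 leqNgt Y_gt0.
Qed.

End Popularity.
End Multipliers.

(** * Popular dilates and the construction of the subring *)

Lemma exists_leq_average (T : choiceType) (X : {fset T}) (f : T -> nat) m :
  X != fset0 -> (#|` X| * m <= \sum_(t <- X) f t)%N ->
  exists2 t, t \in X & (m <= f t)%N.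
Proof.
move=> X0 mf; apply: contrapT => /forall2NP no.
have : (\sum_(t <- X) (f t).+1 <= #|` X| * m)%N.
  by apply: sum_nat_leq_const => t tX; case: (no t) => // /negP; rewrite -ltnNge.
under eq_bigr do rewrite -addn1; rewrite big_split /= -card_fset_sum1 => /leq_trans/(_ mf).
by rewrite -[leqRHS]addn0 leq_add2l leqn0 cardfs_eq0 (negPf X0).
Qed.

(** Katz-Tao: Cauchy-Schwarz on the products u a bounds the sum of |yA & xA| over x, y in [U] below
    by |U|^2 |A| / L. Some x attains the average, and at most half of its share comes from y with
    |yA & xA| < |A| / 2L. *)
Lemma popular_dilate A U (L : nat) :
  U != fset0 -> U `<=` A -> {in U, forall u, injective (fun x => u * x)} ->
  (#|` prodset A A| <= L * #|` A|)%N ->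
  exists2 x, x \in U &
    (#|` U| <=
     2 * L * #|` [fset y in U | (#|` A| <= 2 * L * #|` y :*: A `&` x :*: A|)%N]|)%N.
Proof.
move=> U0 UA injU prodA; pose J y x := #|` y :*: A `&` x :*: A|.
have A_gt0 : (0 < #|` A|)%N.
  by rewrite (leq_trans _ (fsubset_leq_card UA)) // cardfs_gt0.
have total : (#|` U| * (#|` U| * #|` A|) <= \sum_(x <- U) L * \sum_(y <- U) J y x)%N.
  rewrite -(leq_pmul2r A_gt0).
  have coll := @collision2_leq _ _ _ (fun a b => a * b) U A (prodset A A)
    (fun a b aU bA => in_imfset2 _ _ (fsubsetP UA _ aU) bA).
  rewrite -[leqLHS]mulnA mulnAC mulnA mulnn in coll *.
  apply: leq_trans coll _; rewrite -big_distrr /= mulnAC leq_mul //.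
  rewrite [leqRHS]exchange_big /= big_seq [leqRHS]big_seq; apply: leq_sum => y yU.
  rewrite exchange_big /= big_seq [leqRHS]big_seq; apply: leq_sum => x xU.
  (* As multiplication by x is injective, each b admits at most one c with y b = x c. *)
  apply: (@leq_trans #|` [fset b in A | y * b \in x :*: A]|).
    rewrite card_fset_filter; apply: leq_sum => b _.
    have [_|yb] := boolP (y * b \in x :*: A).
      under eq_bigr do rewrite eq_sym.
      by apply: sum_eq_leq1 => c c' _ _; exact: injU.
    rewrite big_seq big1 // => c cA; apply/eqP; rewrite eqb0.
    by apply: contra yb => /eqP ->; exact: mem_ldilate.
  apply: (@leq_size_inj _ _ (fun b => y * b)); first exact: fset_uniq.
    by move=> b b' _ _; exact: (injU y yU).
  by move=> b; rewrite !inE /= => /andP[bA ybx]; rewrite ybx mem_ldilate.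
have [x xU leJ] := exists_leq_average U0 total.
exists x => //; rewrite -(leq_pmul2r A_gt0) card_fset_filter.
(* Multiplied by 2L, the share of y is at most |A| if y is unpopular and 2L |A| if it is popular. *)
suff : (2 * (#|` U| * #|` A|) <= #|` U| * #|` A| + 2 * L *
    (\sum_(y <- U) (#|` A| <= 2 * L * J y x)) * #|` A|)%N.
  by rewrite mul2n -addnn leq_add2l.
apply: leq_trans (leq_mul (leqnn 2) leJ) _.
rewrite mulnA big_distrr /= {1}card_fset_sum1 big_distrl /= [X in (_ <= _ + X)%N]mulnAC.
rewrite [X in (_ <= _ + X)%N]big_distrr -big_split /=; apply: leq_sum => y _.
rewrite mul1n; case: (leqP #|` A| (2 * L * J y x)) => /= [_|/ltnW]; last first.
  by rewrite muln0 addn0.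
rewrite muln1 (leq_trans _ (leq_addl _ _)) // leq_mul //.
by apply: leq_trans (card_ldilate_leq y A); rewrite fsubset_leq_card // fsubsetIl.
Qed.

(* The levels: x^-1 y is an 11-multiplier, x^-1 (y - y') a 27-multiplier, its
   inverse a 36-multiplier, and 63 = 27 + 36; sums of 63-multipliers have level
   131, and applying the counting at level n takes L ^ (n + 10). *)
Lemma sum_product_of_few_singular A (L : nat) :
  A != fset0 -> (1 < L)%N ->
  (#|` A :+: A| <= L * #|` A|)%N -> (#|` prodset A A| <= L * #|` A|)%N ->
  (forall v, #|` singular A v| * L ^ 141 <= #|` A|)%N ->
  exists S a,
    [/\ nonunital_subring S, (#|` S| <= L ^ 70 * #|` A|)%N,
        a \in A /\ invertible a, a :*: S = rdilate S a &
        exists X, [/\ X != fset0, (#|` X| <= L ^ 4)%N & A `<=` a :*: S :+: X]].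
Proof.
move=> A0 L1 dblA prodA sing; have L0 := ltnW L1.
have A_gt0 : (0 < #|` A|)%N by rewrite cardfs_gt0.
pose U := [fset u in A | `[< invertible u >]].
have UA : U `<=` A by apply/fsubsetP => u; rewrite !inE => /andP[].
have invU u : u \in U -> invertible u by rewrite !inE => /andP[_ /asboolP].
(* The non-invertible elements of [A] form [singular A 0]. *)
have halfU : (#|` A| <= 2 * #|` U|)%N.
  have : (#|` A| <= #|` U| + #|` singular A 0|)%N.
    rewrite !card_fset_filter -big_split card_fset_sum1; apply: leq_sum => u _ /=.
    rewrite sub0r; case: asboolP => //=; case: asboolP => // /invertibleN.
    by move=> ? /(_ _); tauto.
  have : (2 * #|` singular A 0| <= #|` A|)%N.
    apply: leq_trans (sing 0); rewrite mulnC leq_mul //.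
    by rewrite (leq_trans L1) // -{1}[L]expn1 leq_exp2l.
  by move: #|` A| #|` U| #|` singular A 0| => p q r; lia.
have U0 : U != fset0 by rewrite -cardfs_gt0; move: halfU A_gt0; lia.
have [x xU] := popular_dilate U0 UA (fun u uU => invertible_lreg (invU u uU)) prodA.
set Y := [fset y in U | _] => UY.
have YU : Y `<=` U by apply/fsubsetP => y; rewrite !inE => /andP[].
have YA := fsubset_trans YU UA.
(* |A| <= 2 |U| <= 4L |Y|, and L >= 2. *)
have denseY : (#|` A| <= L ^ 3 * #|` Y|)%N.
  apply: leq_trans halfU _; apply: leq_trans (leq_mul (leqnn 2) UY) _.
  by rewrite !mulnA leq_mul // (expnS L 2) mulnC leq_mul // -mulnn leq_mul.
have Y0 : Y != fset0.
  rewrite -cardfs_gt0; apply: contraTT A_gt0; rewrite -!leqNgt leqn0 => /eqP Y0.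
  by rewrite (leq_trans denseY) // Y0 muln0.
have xA := fsubsetP UA _ xU; have [x' [xx' x'x]] := invU _ xU.
have singW n : (n + 10 <= 141)%N ->
    {in A, forall v, #|` singular A v| * L ^ (n + 10) <= #|` A|}%N.
  move=> n141 v _; apply: leq_trans (sing v).
  by rewrite leq_mul // leq_exp2l.
(* For Z the intersection of yA and xA, |yA + Z| <= L |A| <= L^3 |Z|; so L^3 translates of Z - Z, a
   subset of xH, cover yA. The level is 3 + 3 + 5. *)
have multY y : y \in Y -> multiplier A L 11 (x' * y).
  rewrite !inE => /andP[_ popy]; apply: (@coverable_multiplier _ _ A0 dblA 3).
  rewrite -ldilateM -[X in coverable _ _ X]ldilate1 -{1}x'x -ldilateM.
  apply: coverable_ldilate; set Z := y :*: A `&` x :*: A in popy.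
  have ZyA : Z `<=` y :*: A by exact: fsubsetIl.
  have ZxA : Z `<=` x :*: A by exact: fsubsetIr.
  have Z0 : Z != fset0.
    rewrite -cardfs_gt0; move: popy A_gt0; case: #|` Z| => //.
    by rewrite muln0 leqNgt => /negPf ->.
  have [|F [_ F3 sub]] := @ruzsa_covering (L ^ 3) (y :*: A) Z Z0.
    apply: (@leq_trans #|` y :*: (A :+: A)|).
      by rewrite ldilateD fsubset_leq_card // sumsetSS.
    apply: leq_trans (card_ldilate_leq _ _) _; apply: leq_trans dblA _.
    apply: leq_trans (leq_mul (leqnn L) popy) _.
    by rewrite mulnA leq_mul // expnS leq_mul // expnS expn1 leq_mul.
  exists F => //; apply: fsubset_trans sub _; apply: sumsetSS => //.
  rewrite ldilateD ldilateM mulrN1 -(mulN1r x) -ldilateM.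
  by rewrite sumsetSS // ldilateS.
have multYY y z : y \in Y -> z \in Y -> multiplier A L 27 (x' * (y - z)).
  move=> yY zY; rewrite mulrBr.
  by apply: (multiplierD A0 dblA (multY y yY)); apply: multiplierN (multY z zY).
have multJ n r : (n + 10 <= 141)%N -> multiplier A L n r ->
    multiplier A L 63 (x' * r * x).
  move=> n141 rP.
  have [a [b [c [d [[aY bY cY dY] [[e [be eb]] rE]]]]]] :=
    multiplier_ratio A0 L1 dblA YA denseY rP (singW _ n141).
  (* Here e inverts b - d, so e x inverts x' (b - d). *)
  have -> : x' * r * x = x' * (c - a) * (e * x).
    by rewrite -rE -!mulrA; congr (_ * (_ * _)); rewrite !mulrA be mul1r.
  apply: (@multiplierM _ _ 27 36); first exact: multYY.
  apply: (@multiplierV _ _ A0 dblA 27 (x' * (b - d))); last exact: multYY.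
    by rewrite -mulrA [(b - d) * _]mulrA be mul1r.
  by rewrite -mulrA [x * _]mulrA xx' mul1r.
have /choice[inv invP] : forall r, exists s, invertible r -> r * s = 1.
  move=> r; have [[s [rs _]]|nr] := pselect (invertible r); first by exists s.
  by exists 0.
(* To be finite by construction, [S] is filtered out of the ratios from Y - Y, among which all
   63-multipliers occur. *)
pose S := [fset r in [fset p * inv q | p in Y :-: Y, q in Y :-: Y]
             | `[< multiplier A L 63 r >]].
have memS r : reflect (multiplier A L 63 r) (r \in S).
  apply: (iffP idP) => [|rP]; first by rewrite !inE => /andP[_ /asboolP].
  have [a [b [c [d [[aY bY cY dY] [bd rE]]]]]] :=
    multiplier_ratio A0 L1 dblA YA denseY rP (singW 63 isT).
  rewrite !inE; apply/andP; split; last exact/asboolP.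
  apply/imfset2P; exists (c - a); first exact: mem_diffset.
  exists (b - d); first exact: mem_diffset.
  by rewrite -rE -mulrA invP // mulr1.
have conjI : injective (fun r => x' * r * x).
  move=> r s /(congr1 (fun t => x * t * x')).
  by rewrite !mulrA xx' !mul1r -!mulrA xx' !mulr1.
(* An injective map of a finite set into itself is onto. *)
have conjS : [fset x' * r * x | r in S] = S.
  apply/eqP; rewrite eqEfcard; apply/andP; split; last by rewrite (card_imfset _ _ conjI) leqnn.
  by apply/fsubsetP => _ /imfsetP[r /= /memS rS ->]; apply/memS/(multJ 63).
(* The conjugate of r has level 63, so it is also the conjugate of an element of [S], which is r by
   injectivity. *)
have gap n r : (n + 10 <= 141)%N -> multiplier A L n r -> r \in S.
  move=> n141 /(multJ _ _ n141)/memS; rewrite -[X in _ \in X]conjS.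
  by move=> /imfsetP[s /= sS /conjI ->].
have subYS y z : y \in Y -> z \in Y -> x' * (y - z) \in S.
  by move=> yY zY; apply: (gap 27) => //; exact: multYY.
exists S, x; split => //.
- split; first split.
  + have [y yY] := fset0Pn _ Y0.
    by have := subYS y y yY yY; rewrite subrr mulr0.
  + move=> r s /memS rS /memS sS; apply: (gap 131) => //.
    by apply: (multiplierD A0 dblA rS); exact: multiplierN.
  + move=> r s /memS rS /memS sS; apply: (gap 126) => //.
    exact: (multiplierM rS sS).
- apply: leq_trans (card_multipliers A0 L1 dblA YA denseY _ (singW 63 isT)) _.
    by move=> r /memS.
  by rewrite leq_mul // fsubset_leq_card.
- by split => //; exists x'.
- apply/fsetP => r; apply/ldilateP/imfsetP => -[s /= sS ->].
    exists (x * s * x'); last by rewrite -!mulrA x'x mulr1.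
    move: sS; rewrite -{1}conjS => /imfsetP[t /= tS ->].
    by rewrite !mulrA xx' mul1r -mulrA xx' mulr1.
  exists (x' * s * x); last by rewrite !mulrA xx' mul1r.
  by rewrite -conjS; apply/imfsetP; exists s.
(* |A + Y| <= L |A| <= L^4 |Y|, and Y - Y lies in xS. *)
have [|F [_ F4 sub]] := @ruzsa_covering (L ^ 4) A Y Y0.
  apply: (@leq_trans #|` A :+: A|); first by rewrite fsubset_leq_card // sumsetSS.
  by apply: leq_trans dblA _; rewrite (expnD L 1 3) expn1 -mulnA leq_mul.
exists F; split => //.
  apply: contraNneq A0 => F0; rewrite -fsubset0; apply: fsubset_trans sub _.
  by rewrite F0; apply/fsubsetP => ? /sumsetP[? [? []]].
apply: fsubset_trans sub _; rewrite sumsetC sumsetSS //.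
apply/fsubsetP => _ /diffsetP[y [z [yY zY ->]]].
by apply/ldilateP; exists (x' * (y - z)); [exact: subYS | rewrite mulrA xx' mul1r].
Qed.

End Sumsets.

(** * Coinciding coordinates in a product of division rings *)

Section ProductOfDivisionRings.
Variables (I : finType) (D : I -> unitRingType).
Local Notation R := {dffun forall j : I, D j}.
Implicit Types (A : {fset R}) (x v : R) (j : I).

Lemma invertible_dffun x :
  (forall j, division_ring (D j)) -> (forall j, x j != 0) -> invertible x.
Proof.
move=> divD x0; exists [ffun j => (x j)^-1 : D j].
by split; apply/ffunP => j; rewrite !dffun_mulE !ffunE ?mulrV ?mulVr // divD.
Qed.

(** For a section [s] of the projection with values in [A], the map from (b, w) to b + s w is
    injective on the fibre: b has the fixed coordinate [v j], so the j-th coordinate of the sum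
    gives w. *)
Lemma card_fiber_leq A v j :
  (#|` [fset b in A | v j == b j]| * #|` [fset proj j x | x in A]| <=
   #|` sumset A A|)%N.
Proof.
have /choice[s sP] : forall w : D j, exists a : R,
    w \in [fset proj j x | x in A] -> a \in A /\ a j = w.
  move=> w; have [/imfsetP[a /= aA ->]|_] := boolP (w \in [fset proj j x | x in A]).
    by exists a.
  by exists 0.
rewrite -(size_allpairs pair).
apply: (@leq_size_inj _ _ (fun p => p.1 + s p.2)).
- by apply: allpairs_uniq => [||[? ?] [? ?] _ _ /= [-> ->]//]; exact: fset_uniq.
- move=> _ _ /allpairsP[[b w] [/= bF wA ->]] /allpairsP[[b' w'] [/= bF' wA' ->]] /= E.
  move: bF bF'; rewrite !inE /= => /andP[_ /eqP vb] /andP[_ /eqP vb'].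
  have ww' : w = w'.
    move/(congr1 (fun x : R => x j)): (E); rewrite /= !dffun_addE -vb -vb'.
    by rewrite (sP _ wA).2 (sP _ wA').2 => /addrI.
  by move: E; rewrite ww' => /addIr ->.
move=> _ /allpairsP[[b w] [/= bF /sP[sA _] ->]] /=.
by apply: mem_sumset => //; move: bF; rewrite !inE => /andP[].
Qed.

Lemma card_singular_leq A v :
  (forall j, division_ring (D j)) ->
  (#|` singular A v| <= \sum_j #|` [fset b in A | v j == b j]|)%N.
Proof.
move=> divD; under eq_bigr do rewrite card_fset_filter.
rewrite exchange_big card_fset_filter /=; apply: leq_sum => b _.
case: asboolP => // ninv; rewrite lt0n sum_nat_eq0.
apply/negP => /forallP vb; apply: ninv; apply: invertible_dffun => // j.
have := vb j; rewrite /= eqb0 => /negPf vbj.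
by rewrite dffun_addE ffunE subr_eq0 vbj.
Qed.

End ProductOfDivisionRings.

(** * The dichotomy, with real [K] replaced by an integer *)

Theorem theorem5p4 :
  exists C : nat,
  forall (Real : realType) (k : nat) (D : 'I_k -> unitRingType)
    (A : {fset {dffun forall j : 'I_k, D j}}) (K : Real),
    (1 <= k)%N ->
    (forall j : 'I_k, division_ring (D j)) ->
    A != fset0%fset ->
    1 <= K ->
    #|` sumset A A|%:R <= K * #|` A|%:R ->
    #|` prodset A A|%:R <= K * #|` A|%:R ->
    (exists j : 'I_k,
       #|` [fset proj j x | x in A]%fset|%:R <= C%:R * k%:R * K ^+ C)
    \/
    (exists (S : {fset {dffun forall j : 'I_k, D j}})
            (a : {dffun forall j : 'I_k, D j}),
       [/\ nonunital_subring S,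
           #|` S|%:R <= C%:R * K ^+ C * #|` A|%:R,
           a \in A /\ invertible a,
           ldilate a S = rdilate S a
         & exists X : {fset {dffun forall j : 'I_k, D j}},
             [/\ X != fset0%fset,
                 #|` X|%:R <= C%:R * K ^+ C
               & (A `<=` sumset (ldilate a S) X)%fset]]).
Proof.
(* Keeping [N] a variable prevents the unary numeral [2 ^ 142] from being
   evaluated. *)
have [N N142] : exists N, (142 <= N)%N by exists 142.
exists (2 ^ N)%N => Real k D A K k_gt0 divD A0 K1 dblA prodA.
have K0 : 0 <= K := le_trans ler01 K1.
(* An integer with K <= L <= 2K; K >= 1 ensures L >= 2. *)
pose L := (Num.truncn K).+1.
have KL : K <= L%:R by rewrite ltW // truncnS_gt.
have LK : L%:R <= 2 * K.
  by rewrite mulr_natl mulr2n -natr1 lerD // truncn_le.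
have L1 : (1 < L)%N by rewrite ltnS truncn_gt0.
(* L^n <= 2^n K^n, so 2^N serves as factor and as exponent. *)
have boundL n : (n <= N)%N -> (L ^ n)%:R <= (2 ^ N)%:R * K ^+ (2 ^ N).
  move=> nN; rewrite natrX (le_trans (lerXn2r n _ _ LK)) ?nnegrE ?mulr_ge0 //.
  rewrite exprMn natrX ler_pM ?exprn_ge0 ?ler_weXn2l ?ler1n //.
  by rewrite (leq_trans nN) // ltnW // ltn_expl.
have natL (m : nat) : m%:R <= K * #|` A|%:R -> (m <= L * #|` A|)%N.
  by move=> mK; rewrite -(ler_nat Real) natrM (le_trans mK) // ler_wpM2r.
have [/existsP[j Aj]|large] := boolP [exists j : 'I_k,
    #|` [fset proj j x | x in A]%fset|%:R <= (2 ^ N)%:R * k%:R * K ^+ (2 ^ N)].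
  by left; exists j.
(* Every projection has more than k L^142 elements, so each fibre has at most |A| / (k L^141), and
   the k coordinates together give at most |A| / L^141. *)
right; have sing v : (#|` singular A v| * L ^ 141 <= #|` A|)%N.
  rewrite -(leq_pmul2l k_gt0).
  apply: leq_trans (leq_mul (leqnn k) (leq_mul (card_singular_leq A v divD) (leqnn _))) _.
  rewrite big_distrl big_distrr /= -[X in (_ <= X * _)%N]card_ord -sum_nat_const.
  apply: leq_sum => j _; rewrite -(leq_pmul2l (ltnW L1)).
  apply: leq_trans (natL _ dblA); apply: leq_trans (card_fiber_leq A v j).
  have comm (l c f m : nat) : (l * (c * (f * m)) = f * (c * (l * m)))%N by lia.
  rewrite comm -expnS leq_mul // -(ler_nat Real).
  move: large; rewrite negb_exists => /forallP/(_ j); rewrite -ltNge => /ltW.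
  by apply: le_trans; rewrite natrM [leLHS]mulrC [leRHS]mulrAC ler_wpM2r // boundL.
have [S [a [subS cardS aA aS [X [X0 X4 AX]]]]] :=
  sum_product_of_few_singular A0 L1 (natL _ dblA) (natL _ prodA) sing.
have small n : (n <= 142)%N -> (n <= N)%N by move/leq_trans; apply.
exists S, a; split => //.
  move: cardS; rewrite -(ler_nat Real) natrM => /le_trans; apply.
  by rewrite ler_wpM2r // boundL // small.
exists X; split => //; move: X4; rewrite -(ler_nat Real) => /le_trans; apply.
by rewrite boundL // small.
Qed.
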